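(* Let $\mathscr{M}$, $\dim\mathscr{M}=n$, be either a smooth compact manifold embedded in a Euclidean space with positive codimension, or a closed compact $n$-dimensional convex surface. If the Weyl polynomial $W_{\mathscr{M}}^{\infty}$ is conservative, then all the Weyl polynomials $W_{\mathscr{M}}^{p}$, $p=1,2,3,\dots$, are conservative as well.
   Context: Weyl coefficients $w_{2l}(\mathscr{M})$, $0\le l\le[n/2]$ (real numbers), are defined as follows. (i) Smooth case: $\mathscr{M}\subset\mathbb{R}^{n+q}$, $q\ge1$, is a compact smooth $n$-dimensional manifold (with or without boundary). The tube of radius $t$ is the union over $x\in\mathscr{M}$ of the closed $q$-dimensional disks of radius $t$ centered at $x$ in the affine normal space to $\mathscr{M}$ at $x$. By H. Weyl's theorem, for all small $t>0$ its $(n+q)$-dimensional volume is $\omega_q t^q\sum_{l=0}^{[n/2]}\frac{2^{-l}\Gamma(\frac q2+1)}{\Gamma(\frac q2+l+1)}w_{2l}(\mathscr{M})t^{2l}$, where $\omega_q=\pi^{q/2}/\Gamma(\frac q2+1)$; this defines $w_{2l}(\mathscr{M})$, and $w_0(\mathscr{M})=\mathrm{Vol}_n(\mathscr{M})$. (ii) Convex case: $\mathscr{M}=\partial V$ with $V\subset\mathbb{R}^{n+1}$ compact convex, and $w_{2l}(\mathscr{M})=2^l\frac{\Gamma(l+\frac12+1)}{\Gamma(\frac12+1)}s_{2l+1}(V)$, where $\mathrm{Vol}_{n+1}(V+tB^{n+1})=\sum_{k=0}^{n+1}s_k(V)t^k$ for $t\ge0$ and $B^{n+1}$ is the closed unit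 ball. In both cases, for every $p=1,2,3,\dots$, $W_{\mathscr{M}}^{p}(t)=\sum_{l=0}^{[n/2]}\frac{2^{-l}\Gamma(\frac p2+1)}{\Gamma(\frac p2+l+1)}w_{2l}(\mathscr{M})t^{2l}$, and $W_{\mathscr{M}}^{\infty}(t)=\sum_{l=0}^{[n/2]}w_{2l}(\mathscr{M})t^{2l}$. A polynomial is conservative if all its roots are purely imaginary and simple. *)

(* Defs.v *)
From HB Require Import structures.
From mathcomp Require Import all_boot all_order all_algebra.
From mathcomp Require Import all_classical all_reals all_analysis.
From mathcomp Require Import complex.

Set Implicit Arguments.
Unset Strict Implicit.
Unset Printing Implicit Defensive.

Import Order.TTheory GRing.Theory Num.Theory.
Import numFieldNormedType.Exports.

Local Open Scope classical_set_scope.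
Local Open Scope ring_scope.

Section Euclidean.
Variables (R : realType) (N : nat).
Implicit Types (u v : 'rV[R]_N) (A : set 'rV[R]_N).

Definition dotr u v : R := \sum_(i < N) u 0 i * v 0 i.

(* The library norm `|u| on row vectors is the sup norm. *)
Definition eucl_norm u : R := Num.sqrt (dotr u u).

(* Lebesgue outer measure on R^N: the infimum of the total volume of the
   countable families of closed boxes [a k, b k] covering A. *)
Definition volume A : \bar R := ereal_inf
  [set s | exists a b : nat -> 'rV[R]_N,
     [/\ forall k i, a k 0 i <= b k 0 i,
         A `<=` \bigcup_k [set x | forall i, a k 0 i <= x 0 i <= b k 0 i]
       & s = (\sum_(0 <= k <oo) (\prod_(i < N) (b k 0 i - a k 0 i))%:E)%E]].

(* A + t B, with B the closed Euclidean unit ball *)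
Definition parallel_body A (t : R) : set 'rV[R]_N :=
  [set y | exists x u, [/\ A x, eucl_norm u <= 1 & y = x + t *: u]].

Definition boundary A : set 'rV[R]_N := closure A `\` interior A.

End Euclidean.

Section Smooth.
Variables (R : realType) (V W : normedModType R).

(* C^k on the open set U *)
Fixpoint Ck_on (k : nat) (U : set V) (f : V -> W) : Prop :=
  if k is k'.+1 then
    (forall x, U x -> differentiable f x) /\ (forall v, Ck_on k' U ('D_v f))
  else forall x, U x -> {for x, continuous f}.

Definition smooth_on (U : set V) (f : V -> W) : Prop := forall k, Ck_on k U f.

End Smooth.

Section Submanifold.
Variables (R : realType) (n q : nat).
Notation E := 'rV[R]_(n + q).
Implicit Types (M U : set E) (phi psi : E -> E).

(* R^n x 0, or the half-space {z_0 >= 0} of it when bd holds *)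
Definition slice (bd : bool) : set E :=
  [set z | (forall j : 'I_q, z 0 (rshift n j) = 0) /\
           (bd -> forall i : 'I_n, i = 0 :> nat -> 0 <= z 0 (lshift q i))].

(* phi is a diffeomorphism from U onto U', with inverse psi, which flattens M *)
Definition slice_chart M U (U' : set E) phi psi : Prop :=
  [/\ open U /\ open U',
      smooth_on U phi /\ smooth_on U' psi,
      forall y, U y -> U' (phi y) /\ psi (phi y) = y,
      forall z, U' z -> U (psi z) /\ phi (psi z) = z
    & exists bd, forall y, U y -> (M y <-> slice bd (phi y))].

(* n-dimensional embedded smooth submanifold, with or without boundary *)
Definition smooth_submanifold M : Prop :=
  forall x, M x -> exists U U' phi psi, U x /\ slice_chart M U U' phi psi.

(* The image of R^n x 0 under the differential of the inverse chart, hence the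
   full n-dimensional tangent space also at boundary points. *)
Definition tangent_space M (x : E) : set E :=
  [set v | exists U U' phi psi, [/\ U x, slice_chart M U U' phi psi
     & exists h : 'rV[R]_n, v = 'd psi (phi x) (row_mx h 0)]].

Definition normal_space M (x : E) : set E :=
  [set w | forall v, tangent_space M x v -> dotr w v = 0].

Definition tube M (t : R) : set E :=
  [set y | exists x, [/\ M x, normal_space M x (y - x)
                       & eucl_norm (y - x) <= t]].

End Submanifold.

Section WeylPolynomials.
Variable R : realType.

Definition Gamma (x : R) : R :=
  \int[lebesgue_measure]_(t in `]0, +oo[) (t `^ (x - 1) * expR (- t)).

(* volume of the q-dimensional unit ball *)
Definition ball_volume (q : nat) : R := pi `^ (q%:R / 2) / Gamma (q%:R / 2 + 1).

(* W^p and W^oo; only the even-indexed values w_0, w_2, ... of w occur. *)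
Definition weyl_poly (n : nat) (w : nat -> R) (p : nat) : {poly R} :=
  \sum_(l < n./2.+1)
    (2 ^- l * Gamma (p%:R / 2 + 1) / Gamma (p%:R / 2 + l%:R + 1)
       * w (2 * l)%N) *: 'X^(2 * l).

Definition weyl_poly_oo (n : nat) (w : nat -> R) : {poly R} :=
  \sum_(l < n./2.+1) w (2 * l)%N *: 'X^(2 * l).

(* weyl_coefficients n M w: M is an n-dimensional manifold of one of the two
   kinds considered and w (2 * l) = w_{2l}(M) for 0 <= l <= [n/2]. *)
Inductive weyl_coefficients (n : nat) :
    forall N : nat, set 'rV[R]_N -> (nat -> R) -> Prop :=
| Weyl_smooth (q : nat) (M : set 'rV[R]_(n + q)) (w : nat -> R) :
    (0 < q)%N -> compact M -> smooth_submanifold M ->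
    (\forall t \near 0^'+, volume (tube M t) =
       (ball_volume q * t ^+ q * (weyl_poly n w q).[t])%:E) ->
    weyl_coefficients n M w
| Weyl_convex (V : set 'rV[R]_(n.+1)) (s w : nat -> R) :
    compact V -> convex_set V ->
    (forall t : R, 0 <= t -> volume (parallel_body V t) =
       (\sum_(k < n.+2) s k * t ^+ k)%:E) ->
    (forall l, (l <= n./2)%N -> w (2 * l)%N =
       2 ^+ l * Gamma (l%:R + 1 / 2 + 1) / Gamma (1 / 2 + 1) * s (2 * l).+1) ->
    weyl_coefficients n (boundary V) w.

(* Roots are taken in the complex field R[i]. *)
Definition conservative (P : {poly R}) : Prop :=
  let PC : {poly R[i]} := map_poly (real_complex R) P in
  forall z : R[i], root PC z -> complex.Re z = 0 /\ mup z PC = 1%N.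

End WeylPolynomials.

(* Main.v *)
Require Import Defs.
From mathcomp Require Import all_boot all_order all_algebra.
From mathcomp Require Import all_classical all_reals all_analysis.
From mathcomp Require Import complex polyrcf measurable_realfun ring lra.

Set Implicit Arguments.
Unset Strict Implicit.
Unset Printing Implicit Defensive.

Import Order.TTheory GRing.Theory Num.Theory.
Import numFieldNormedType.Exports.

Local Open Scope classical_set_scope.
Local Open Scope ring_scope.

(* By Gamma (x + 1) = x * Gamma x, the coefficients of W^p come from those of
   W^oo through the multipliers 2^-l / ((a + 1) ... (a + l)) with a = p / 2.
   Both polynomials are even; in the variable t^2 a conservative polynomial is
   one with simple negative roots only, so it suffices that the operator
   T_a : 'X^l |-> 'X^l / ((a + 1) ... (a + l)) maps polynomials with negative
   roots to polynomials with simple negative roots (Laguerre). This goes by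
   induction on the degree, for all a > -1 at once: if L = T_(a + 1) p, then
     T_a (('X - v) p) = 'X (L - v L') / (a + 1) - v L,
   whose signs alternate at 0, at the successive roots of L, and near -oo. *)

(** * Functional equation and positivity of Euler's Gamma function for arguments above 1 *)

Section Gamma.
Variable R : realType.
Implicit Types x t : R.
Notation mu := (@lebesgue_measure R).

(** Raising [t / (2 * x) <= expR (t / (2 * x))] to the power [x] bounds [t ^ x] by
    [(2 * x) ^ x * expR (t / 2)]. The right-hand side serves as dominating function for limits,
    integrability and sign arguments. *)
Lemma powR_expRN_le x t : 0 < x -> 0 <= t ->
  t `^ x * expR (- t) <= (2 * x) `^ x * expR (- (t / 2)).
Proof.
move=> x0 t0; have x20 : 0 < 2 * x by rewrite mulr_gt0.
have -> : expR (- t) = expR (- (t / 2)) / expR (t / 2).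
  by rewrite -expRB; congr expR; field.
rewrite mulrCA mulrC ler_wpM2r ?expR_ge0// ler_pdivrMr ?expR_gt0//.
have -> : t / 2 = t / (2 * x) * x by field; rewrite gt_eqF.
rewrite expRM -powRM ?expR_ge0 ?(ltW x20)//.
apply: (ge0_ler_powR (ltW x0)); rewrite ?nnegrE ?mulr_ge0 ?expR_ge0 ?(ltW x0)//.
rewrite -ler_pdivrMl// mulrC (le_trans _ (expR_ge1Dx _))//.
by rewrite lerDr.
Qed.

Lemma cvgy_expRN_half : expR (- (t / 2)) @[t --> +oo] --> (0 : R).
Proof.
apply: (@cvg_comp _ _ _ (fun t => t / 2) (fun t => expR (- t)) _ (pinfty_nbhs R)).
  by apply: gt0_cvgMly.
exact: cvgr_expR.
Qed.

Lemma cvgy_powR_expRN x : 0 < x -> t `^ x * expR (- t) @[t --> +oo] --> (0 : R).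
Proof.
move=> x0.
apply: (@squeeze_cvgr _ _ _ _ (cst 0)
  (fun t => (2 * x) `^ x * expR (- (t / 2)))).
- near=> t; rewrite mulr_ge0 ?powR_ge0 ?expR_ge0//=.
  by apply: powR_expRN_le => //; near: t; apply: nbhs_pinfty_ge; exact: num_real.
- exact: cvg_cst.
- rewrite -[X in _ --> X](mulr0 ((2 * x) `^ x)).
  apply: cvgM; first exact: cvg_cst.
  exact: cvgy_expRN_half.
Unshelve. all: end_near. Qed.

Lemma is_derive_powR_expRN x t : 0 < t ->
  is_derive t 1 (fun u => u `^ x * expR (- u))
    (x * t `^ (x - 1) * expR (- t) - t `^ x * expR (- t)).
Proof.
move=> t0.
have H1 := is_derive1_powR x t0.
have H2 : is_derive t 1 (fun u : R => expR (- u)) (- expR (- t)).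
  apply: is_derive_eq.
  by rewrite mulrN1.
have := is_deriveM H1 H2 => H; apply: (is_derive_eq H).
rewrite /GRing.scale/=; ring.
Qed.

Lemma within_continuous_powR_expRN x : 0 < x ->
  {within `[0, +oo[, continuous (fun t => t `^ x * expR (- t))}.
Proof.
move=> x0; apply/continuous_within_itvcyP; split.
  move=> t; rewrite in_itv/= andbT => t0.
  apply: differentiable_continuous; apply/derivable1_diffP.
  by have [] := is_derive_powR_expRN x t0.
rewrite powR0 ?gt_eqF// mul0r -[X in _ --> X](mul0r (expR (- 0))).
apply: cvgM; first exact: powR_cvg0.
apply: cvg_at_right_filter.
by apply: continuous_comp; [exact: opp_continuous|exact: continuous_expR].
Qed.

Lemma integral_expRN_half :
  (\int[mu]_(t in `[0%R, +oo[) (expR (- (t / 2)))%:E = 2%:E)%E.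
Proof.
have dF : forall s : R, is_derive s 1 (fun u : R => - 2 * expR (- (u / 2))) (expR (- (s / 2))).
  move=> s; apply: is_derive_eq.
  rewrite /GRing.scale/=; by field.
have cF : continuous (fun u : R => expR (- (u / 2))).
  move=> u; apply: continuous_comp; last exact: continuous_expR.
  by apply: continuousN; apply: mulrr_continuous.
apply: etrans; first apply: (@ge0_continuous_FTC2y _ (fun u : R => expR (- (u / 2)))
    (fun u : R => - 2 * expR (- (u / 2))) 0 0).
- by move=> x _; exact: expR_ge0.
- by apply: continuous_subspaceT => t; exact: cF.
- rewrite -[X in _ --> X](mulr0 (-2)).
  by apply: cvgM; [exact: cvg_cst|exact: cvgy_expRN_half].
- by move=> x _; have [] := dF x.
- apply: cvg_at_right_filter; apply: cvgM; first exact: cvg_cst.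
  exact: cF.
- by move=> x _; rewrite derive1E; have [_ ->] := dF x.
by rewrite /= mul0r oppr0 expR0 -EFinB; congr EFin; ring.
Qed.

Lemma measurable_powR_expRN x (D : set R) : measurable D ->
  measurable_fun D (fun t => t `^ x * expR (- t)).
Proof.
move=> mD; apply: measurable_funM.
  by apply: measurable_funTS; exact: measurable_powR.
apply: measurableT_comp => //; exact: measurableT_comp.
Qed.

Lemma integrable_expRN_half :
  mu.-integrable `[0, +oo[ (fun t => (expR (- (t / 2)))%:E).
Proof.
apply/integrableP; split.
  apply/measurable_EFinP; apply: measurableT_comp => //.
  by apply: measurableT_comp => //; apply: measurable_funM.
under eq_integral do rewrite /= ger0_norm ?expR_ge0//.
by rewrite integral_expRN_half ltry.
Qed.

Lemma integrable_powR_expRN x : 0 < x ->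
  mu.-integrable `[0, +oo[ (fun t => (t `^ x * expR (- t))%:E).
Proof.
move=> x0.
have : mu.-integrable `[0, +oo[
    (fun t => ((2 * x) `^ x * expR (- (t / 2)))%:E).
  exact: (integrableZl _ _ integrable_expRN_half).
apply: le_integrable => //; first by apply/measurable_EFinP; apply: measurable_powR_expRN.
move=> t/=; rewrite in_itv/= andbT => t0.
rewrite lee_fin !ger0_norm ?mulr_ge0 ?powR_ge0 ?expR_ge0//.
exact: powR_expRN_le.
Qed.

(** Closing the interval at 0 does not change the integral; for [x > 1] the integrand is continuous
    there, as the fundamental theorem of calculus on [[0, +oo[] requires. *)
Lemma GammaE x : 1 < x ->
  Gamma x = \int[mu]_(t in `[0, +oo[) (t `^ (x - 1) * expR (- t)).
Proof.
move=> x1; have x10 : 0 < x - 1 by lra.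
rewrite /Gamma Rintegral_itv_obnd_cbnd//.
apply: integrableS (integrable_powR_expRN x10) => //.
by apply: subset_itvr; rewrite bnd_simp.
Qed.

Lemma GammaS x : 1 < x -> Gamma (x + 1) = x * Gamma x.
Proof.
move=> x1; have x0 : 0 < x by lra.
have x10 : 0 < x - 1 by lra.
(* The derivative of - t^x e^-t changes sign; adding the integrable dominating
   function h makes it nonnegative, as the improper FTC requires. *)
pose h t := x * (2 * (x - 1)) `^ (x - 1) * expR (- (t / 2)).
have ih : mu.-integrable `[0, +oo[ (EFin \o h).
  exact: (integrableZl _ _ integrable_expRN_half).
have i1 := integrable_powR_expRN x0.
have i0 := integrable_powR_expRN x10.
have i0' : mu.-integrable `[0, +oo[
    (fun t => (x * (t `^ (x - 1) * expR (- t)))%:E).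
  exact: (integrableZl _ x i0).
have dh : forall s : R, is_derive s 1 (fun u => - 2 * h u) (h s).
  move=> s; apply: is_derive_eq.
  by rewrite /GRing.scale/= /h; field.
rewrite !GammaE// ?addrK; last lra.
have -> : \int[mu]_(t in `[0, +oo[) (t `^ x * expR (- t)) =
    \int[mu]_(t in `[0, +oo[) (x * (t `^ (x - 1) * expR (- t))).
  apply/eqP; rewrite -subr_eq0 -RintegralB//; apply/eqP.
  apply: (addIr (\int[mu]_(t in `[0, +oo[) h t)).
  rewrite -RintegralD//; last exact: (integrableB _ i1 i0').
  rewrite add0r.
  have hy : - 2 * h t @[t --> +oo] --> 0.
    rewrite -[X in _ --> X](mulr0 (-2)); apply: cvgMr.
    rewrite -[X in _ --> X](mulr0 (x * (2 * (x - 1)) `^ (x - 1))); apply: cvgMr.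
    exact: cvgy_expRN_half.
  have ch : continuous h.
    move=> u; apply: cvgMr.
    apply: continuous_comp; last exact: continuous_expR.
    by apply: continuousN; apply: mulrr_continuous.
  have h2 : - 2 * h t @[t --> 0^'+] --> - 2 * h 0.
    by apply: cvg_at_right_filter; apply: cvgMr; exact: ch.
  (* With or without the added derivative of [- t ^ x * expR (- t)], the integral of [h] equals
     [2 * h 0], because [t ^ x * expR (- t)] vanishes both at 0 and at +oo. Hence the derivative
     integrates to 0. *)
  transitivity (0 - (- 2 * h 0)).
    apply: etrans; first apply: (@Rintegral_ge0_continuous_FTC2y _ _
      (fun t => - 2 * h t - t `^ x * expR (- t)) 0 0).
    - move=> t t0; rewrite -addrA addr_ge0 ?mulr_ge0 ?powR_ge0 ?expR_ge0//.
      rewrite addrC subr_ge0 /h -[leRHS]mulrA ler_wpM2l ?(ltW x0)//.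
      exact: powR_expRN_le.
    - have /subspace_continuousP c1 := within_continuous_powR_expRN x0.
      have /subspace_continuousP c0 := within_continuous_powR_expRN x10.
      apply/subspace_continuousP => t t0; apply: cvgD.
        by apply: cvgB; [exact: c1|apply: cvgMr; exact: c0].
      exact: cvg_within_filter (ch t).
    - rewrite -[X in _ --> X](subr0 0); apply: cvgB => //.
      exact: cvgy_powR_expRN.
    - move=> t t0; have [d1 _] := is_deriveB (dh t) (is_derive_powR_expRN x t0).
      exact: d1.
    - apply: cvgB => //.
      by have /continuous_within_itvcyP[] := within_continuous_powR_expRN x0.
    - move=> t; rewrite in_itv/= andbT => t0.
      rewrite derive1E.
      have [_ ->] := is_deriveB (dh t) (is_derive_powR_expRN x t0).
      ring.
    by rewrite /= powR0 ?gt_eqF// mul0r subr0.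
  apply/esym; apply: etrans; first apply: (@Rintegral_ge0_continuous_FTC2y _ _
      (fun t => - 2 * h t) 0 0) => //.
    - by move=> t t0; rewrite /h !mulr_ge0 ?powR_ge0 ?expR_ge0 ?(ltW x0).
    - exact: continuous_subspaceT.
    - by move=> t _; rewrite derive1E; have [_ ->] := dh t.
  by [].
by rewrite RintegralZl.
Qed.

(** The integrand is nonnegative, and on [[1, 2]], of length 1, it is at least [expR (- 2)] because
    [t ^ (x - 1) >= 1] there. *)
Lemma Gamma_gt0 x : 1 < x -> 0 < Gamma x.
Proof.
move=> x1; have x10 : 0 < x - 1 by lra.
apply: (@lt_le_trans _ _ (expR (- 2))); first exact: expR_gt0.
have If := integrable_fin_num (measurable_itv _ : measurable (_ : set (measurableTypeR R))) (integrable_powR_expRN x10).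
rewrite GammaE// /Rintegral -lee_fin fineK//.
apply: (@le_trans _ _ (\int[mu]_(t in `[1%R : R, 2%R : R]) (t `^ (x - 1) * expR (- t))%:E)%E).
  apply: (@le_trans _ _ (\int[mu]_(t in `[1%R : R, 2%R : R]) (cst (expR (- 2))%:E t))%E).
    rewrite integral_cst//= lebesgue_measure_itv/= lte_fin ltr1n -EFinB -EFinM lee_fin.
    by rewrite ler_peMr ?expR_ge0//; lra.
  apply: ge0_le_integral => //=.
  - by apply/measurable_EFinP; apply: measurable_powR_expRN.
  - move=> t; rewrite in_itv/= => /andP[t1 t2].
    rewrite lee_fin -[leLHS]mul1r ler_pM ?expR_ge0 ?ler_expR ?lerN2//.
    by rewrite -[leLHS](powRr0 t) ler_powR// ltW.
apply: ge0_subset_integral => //.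
- by apply/measurable_EFinP; apply: measurable_powR_expRN.
- by move=> t _; rewrite lee_fin mulr_ge0 ?powR_ge0 ?expR_ge0.
- by move=> t/=; rewrite !in_itv/= => /andP[t1 _]; rewrite andbT (le_trans _ t1).
Qed.
End Gamma.

(** * The multiplier operator [T_a] and its effect on polynomials with negative roots *)

Section Laguerre.
Variable F : rcfType.
Implicit Types (a c r : F) (p q : {poly F}).

(** The Pochhammer symbol of [a + 1]; for [a > 0] it is the quotient of [Gamma (a + l + 1)] by
    [Gamma (a + 1)]. *)
Definition rising a l : F := \prod_(i < l) (a + i.+1%:R).

(** The operator [T_a]. It sends [(1 - 'X) ^ n] to a scalar multiple of the Laguerre polynomial of
    degree [n] and parameter [a]. *)
Definition laguerre a p : {poly F} := \poly_(l < size p) (p`_l / rising a l).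

Lemma rising_gt0 a l : -1 < a -> 0 < rising a l.
Proof.
move=> a1; apply: prodr_gt0 => i _.
have : 1 <= i.+1%:R :> F by rewrite ler1n.
lra.
Qed.

Lemma risingS a l : rising a l.+1 = rising a l * (a + l.+1%:R).
Proof. by rewrite /rising big_ord_recr. Qed.

Lemma rising_recl a l : rising a l.+1 = (a + 1) * rising (a + 1) l.
Proof.
rewrite /rising big_ord_recl; congr (_ * _).
by apply: eq_bigr => i _; rewrite -addrA [1 + _]addrC natr1.
Qed.

Lemma coef_laguerre a p l : (laguerre a p)`_l = p`_l / rising a l.
Proof.
rewrite coef_poly; case: ltnP => // /(nth_default 0) ->.
by rewrite mul0r.
Qed.

Lemma laguerreZ a c p : laguerre a (c *: p) = c *: laguerre a p.
Proof. by apply/polyP => l; rewrite coefZ !coef_laguerre coefZ mulrA. Qed.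

Lemma size_laguerre a p : -1 < a -> size (laguerre a p) = size p.
Proof.
move=> a1; have [->|p0] := eqVneq p 0.
  by rewrite /laguerre size_poly0 poly_def big_ord0 size_poly0.
apply: size_poly_eq; rewrite -/(lead_coef p) mulf_neq0 ?lead_coef_eq0//.
by rewrite invr_eq0 gt_eqF// rising_gt0.
Qed.

Lemma lead_coef_laguerre a p : -1 < a ->
  lead_coef (laguerre a p) = lead_coef p / rising a (size p).-1.
Proof. by move=> a1; rewrite /lead_coef size_laguerre// coef_laguerre. Qed.

(** Multiplication by ['X] shifts the index, which turns [rising (a + 1) l] into [rising a l.+1] up
    to the factor [a + 1]. For the part in [v], ['X] times the derivative multiplies ['X^l] by [l],
    and [1 + l / (a + 1)] is the ratio of [rising (a + 1) l] to [rising a l]. *)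
Lemma laguerre_mulXsubC a v p : -1 < a ->
  let L := laguerre (a + 1) p in
  laguerre a (('X - v%:P) * p) =
  (a + 1)^-1 *: ('X * (L - v *: L^`())) - v *: L.
Proof.
move=> a1 /=; apply/polyP => l.
have a10 : a + 1 != 0 by lra.
have aS k : a + k.+1%:R != 0.
  by have : 1 <= k.+1%:R :> F; [rewrite ler1n|lra].
have rk k : rising a k != 0 by rewrite gt_eqF// rising_gt0.
have h k : rising (a + 1) k = rising a k * (a + k.+1%:R) / (a + 1).
  by rewrite -risingS rising_recl mulrAC mulfV// mul1r.
rewrite coef_laguerre mulrBl mul_polyC !(coefB, coefZ, coefXM).
rewrite coef_deriv !coef_laguerre.
case: l => [|l] /=; first by rewrite /rising !big_ord0 !mulr0 !sub0r !divr1.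
rewrite !h -mulr_natr !risingS; field.
by rewrite a10 rk [1 + _]addrC natr1 -[2 + _]natrD !aS.
Qed.

(** The intermediate value theorem gives a root in each of the [k] disjoint gaps between consecutive
    [x i]; as [q] has degree [k], there are no others. *)
Lemma alternating_roots q k (x : nat -> F) :
  size q = k.+1 ->
  (forall i j, (i < j <= k)%N -> x j < x i) ->
  (forall i, (i <= k)%N -> 0 < (-1) ^+ i * q.[x i]) ->
  exists u : nat -> F,
    [/\ forall i, (i < k)%N -> x i.+1 < u i < x i,
        forall i j, (i < j < k)%N -> u j < u i
      & q = lead_coef q *: \prod_(i < k) ('X - (u i)%:P)].
Proof.
move=> sq xdec xalt.
have /fin_all_exists[v hv] (i : 'I_k) : exists v, x i.+1 < v < x i /\ root q v.
  have xi : x i.+1 < x i by apply: xdec; rewrite ltnSn ltn_ord.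
  have h0 := xalt i (ltnW (ltn_ord i)); have h1 := xalt i.+1 (ltn_ord i).
  pose p := (-1) ^+ i *: q.
  have p0 : 0 < p.[x i] by rewrite hornerZ.
  have p1 : p.[x i.+1] < 0 by rewrite hornerZ -oppr_gt0 -mulNr -[X in - X]mul1r -mulNr -exprS.
  have [|c /andP[c1 c2]] := @poly_ivt _ p _ _ (ltW xi).
    by rewrite (ltW p0) (ltW p1).
  rewrite rootZ ?signr_eq0// => rc; exists c; split=> //.
  rewrite !lt_neqAle c1 c2 !andbT; apply/andP; split; apply/eqP => e.
    by move: p1; rewrite e hornerZ (rootP rc) mulr0 ltxx.
  by move: p0; rewrite -e hornerZ (rootP rc) mulr0 ltxx.
(* Extends [v] from ordinals to [nat]; the default 0 is taken only for [i >= k]. *)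
pose u i := if insub i is Some j then v j else 0.
have uE (i : 'I_k) : u i = v i.
  by rewrite /u; case: insubP => [j _ /val_inj->|]; rewrite ?ltn_ord.
have ux i : (i < k)%N -> x i.+1 < u i < x i.
  by move=> ik; rewrite (uE (Ordinal ik)); case: (hv (Ordinal ik)).
have udec i j : (i < j < k)%N -> u j < u i.
  move=> /andP[ij jk]; have /andP[_ uj] := ux j jk.
  have /andP[ui _] := ux i (ltn_trans ij jk).
  apply: (lt_le_trans uj); apply: le_trans (ltW ui).
  move: ij; rewrite leq_eqVlt => /predU1P[->//|ij].
  by apply/ltW/xdec; rewrite ij ltnW.
exists u; split=> //.
rewrite -(big_mkord xpredT (fun i => 'X - (u i)%:P)) -(big_map u xpredT (fun z => 'X - z%:P)) /=.
apply: all_roots_prod_XsubC.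
- by rewrite sq size_map size_iota subn0.
- apply/allP => _ /mapP[i + ->]; rewrite mem_index_iota => /= ik.
  by rewrite (uE (Ordinal ik)); case: (hv (Ordinal ik)).
rewrite uniq_rootsE map_inj_in_uniq ?iota_uniq// => i j.
rewrite !mem_index_iota /= => ik jk /eqP.
case: (ltngtP i j) => // ij.
  by rewrite gt_eqF// udec// ij jk.
by rewrite lt_eqF// udec// ij ik.
Qed.

(** At the root [w i] the derivative is the product of the [w i - w j] with [j != i], and exactly
    the [i] factors with [j < i] are negative. *)
Lemma sign_deriv_prod_XsubC k (w : nat -> F) i :
  (forall i j, (i < j < k)%N -> w j < w i) -> (i < k)%N ->
  0 < (-1) ^+ i * (\prod_(j < k) ('X - (w j)%:P))^`().[w i].
Proof.
move=> wdec ik; rewrite (bigD1 (Ordinal ik))//= derivM derivXsubC mul1r.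
rewrite hornerD hornerM hornerXsubC subrr mul0r addr0 horner_prod.
(* The sign is distributed over the factors, one [-1] for each [j < i], so that every factor becomes
   positive. *)
have -> : (-1) ^+ i = \prod_(j < k | j != Ordinal ik) (if (j < i)%N then -1 else 1 : F).
  rewrite -big_mkcondr/= (eq_bigl (fun j : 'I_k => j < i)%N); last first.
    by move=> j; rewrite -val_eqE/=; case: ltngtP.
  by rewrite (big_ord_narrow (ltnW ik))/= prodr_const card_ord.
rewrite -big_split/=; apply: prodr_gt0 => j ji; rewrite hornerXsubC.
move: ji; rewrite -val_eqE/= neq_ltn; case: ltnP => [ji _|_ /= ij].
  by rewrite mulN1r opprB subr_gt0 wdec// ji.
by rewrite mul1r subr_gt0 wdec// ij ltn_ord.
Qed.


(** Repetitions in [vs] are allowed, whereas the strict decrease of [u] records that the new roots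
    are simple and orders them for the sign count of the next step. *)
Lemma laguerre_prod_XsubC a (vs : seq F) : -1 < a -> {in vs, forall v, v < 0} ->
  exists u : nat -> F,
    [/\ forall i, (i < size vs)%N -> u i < 0,
        forall i j, (i < j < size vs)%N -> u j < u i
      & let q := laguerre a (\prod_(v <- vs) ('X - v%:P)) in
        q = lead_coef q *: \prod_(i < size vs) ('X - (u i)%:P)].
Proof.
elim: vs a => [|v vs IH] a a1 vs0.
  exists (fun=> 0); split=> //= [i j /andP[]//|].
  rewrite big_nil big_ord0 alg_polyC; apply/polyP => l.
  rewrite lead_coef_laguerre// lead_coef1 size_poly1 /rising big_ord0 divr1.
  rewrite coef_laguerre !coef1 /rising; case: l => [|l].
    by rewrite big_ord0 divr1.
  by rewrite mul0r.
have v0 : v < 0 by apply: vs0; rewrite mem_head.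
have {}vs0 : {in vs, forall v, v < 0} by move=> z zs; rewrite vs0// mem_behead.
have a11 : -1 < a + 1 by lra.
have [w [w0 wdec]] := IH _ a11 vs0.
set p := \prod_(_ <- vs) _; set L := laguerre _ p => /= LE.
set k := size vs in w0 wdec LE *.
rewrite big_cons -/p; set q := laguerre a _.
have qE : q = (a + 1)^-1 *: ('X * (L - v *: L^`())) - v *: L.
  exact: laguerre_mulXsubC.
have sp : size p = k.+1 by rewrite /p size_prod_XsubC.
have lp : lead_coef p = 1 by rewrite /p lead_coef_prod_XsubC.
have lL : 0 < lead_coef L.
  by rewrite lead_coef_laguerre// lp mul1r invr_gt0 rising_gt0.
have L0 : 0 < L.[0].
  rewrite horner_coef0 coef_laguerre /rising big_ord0 divr1 -horner_coef0.
  rewrite horner_prod big_seq; apply: prodr_gt0 => z zs.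
  by rewrite hornerXsubC sub0r oppr_gt0 vs0.
have sq : size q = k.+2.
  by rewrite size_laguerre// size_monicM ?monicXsubC ?monic_neq0 ?monic_prod_XsubC// size_XsubC sp.
have lq : 0 < lead_coef q.
  rewrite lead_coef_laguerre// lead_coefM lp lead_coefXsubC mul1r.
  by rewrite mul1r invr_gt0 rising_gt0.
have Lw i : (i < k)%N -> L.[w i] = 0.
  move=> ik; rewrite LE hornerZ (bigD1 (Ordinal ik))//= hornerM hornerXsubC.
  by rewrite subrr mul0r mulr0.
(* The last sample point: near -oo, [q] has the sign of [(-1) ^+ k.+1], as seen on [q \Po - 'X] near
   +oo. Since all [w i] are negative, their sum is a lower bound for each of them; if [k = 0] it is
   0, so [M] is negative in every case. *)
have [M [M0 MS]] : exists M, 0 < (-1) ^+ k.+1 * q.[M] /\ M < \sum_(i < k) w i.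
  have [|n hn] := @poly_pinfty_gt_lc _ ((-1) ^+ k.+1 *: (q \Po - 'X)).
    rewrite lead_coefZ lead_coef_comp ?size_polyN ?size_polyX//.
    by rewrite lead_coefN lead_coefX sq mulrCA -expr2 sqrr_sign mulr1.
  pose m := Num.max n (1 - \sum_(i < k) w i).
  have := hn m; rewrite le_max lexx/= => /(_ isT).
  rewrite lead_coefZ lead_coef_comp ?size_polyN ?size_polyX//.
  rewrite lead_coefN lead_coefX sq mulrCA -expr2 sqrr_sign mulr1.
  rewrite hornerZ horner_comp hornerN hornerX => qm.
  exists (- m); split; first exact: lt_le_trans qm.
  by rewrite ltrNl lt_max (_ : - _ < 1 - _) ?orbT//; lra.
have Mw i : (i < k)%N -> M < w i.
  move=> ik; apply: (lt_le_trans MS).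
  rewrite (bigD1 (Ordinal ik))//= gerDl sumr_le0// => j _.
  by rewrite ltW// w0.
have M_lt0 : M < 0.
  by apply: (lt_le_trans MS); apply: sumr_le0 => j _; rewrite ltW// w0.
(* The [k + 2] sample points [0 > w 0 > ... > w (k - 1) > M]; the roots [w] are shifted by one
   index. *)
pose x i := if i is j.+1 then if (j < k)%N then w j else M else 0.
have [||u [ux udec uE]] := @alternating_roots q k.+1 x sq.
- move=> [|i] [|j]//=; first by case: (ltnP j k) => // jk _; exact: w0.
  rewrite !ltnS => /andP[ij jk]; rewrite (leq_trans ij jk).
  case: (ltnP j k) => // jk'; first by rewrite wdec// ij.
  by rewrite Mw// (leq_trans ij).
- move=> [|i] /= ik.
    rewrite mul1r qE hornerD hornerN !hornerZ hornerM hornerX mul0r mulr0 sub0r -mulNr.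
    by rewrite mulr_gt0// oppr_gt0.
  case: (ltnP i k) => [{}ik|ki]; last first.
    by have -> : i = k by apply/eqP; rewrite eqn_leq ki -ltnS ik.
  have D0 := sign_deriv_prod_XsubC wdec ik.
  (* As [L] vanishes at [w i], only the term in [L^]()[survives;]w
     i[and]v[are both negative, so]q[has there the sign opposite to that of]L^[()]. *)
  have -> : (-1) ^+ i.+1 * q.[w i] = (a + 1)^-1 * - w i * - v * lead_coef L *
      ((-1) ^+ i * (\prod_(j < k) ('X - (w j)%:P))^`().[w i]).
    rewrite qE !(hornerD, hornerN, hornerZ, hornerM, hornerX) (Lw i ik) [in LHS]LE derivZ hornerZ exprS.
    by ring.
  apply: mulr_gt0 D0; rewrite !mulr_gt0 ?invr_gt0 ?oppr_gt0 ?w0//; lra.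
exists u; split=> // i ik.
have /andP[_ ui] := ux i ik; apply: (lt_le_trans ui).
by case: i {ui} ik => //= i; rewrite ltnS => ik; rewrite ik ltW// w0.
Qed.

End Laguerre.

(** * Conservative even polynomials and negative roots in the squared variable *)

Section Conservative.
Variable R : realType.
Implicit Types (p q : {poly R}).

Notation toC := (real_complex R).

Lemma sqr_complex_real_lt0 (z : R[i]) (v : R) : v < 0 -> z ^+ 2 = toC v ->
  complex.Re z = 0.
Proof.
case: z => x y /= v0 [/= e1 e2].
have : x * y = 0 by lra.
move=> /eqP; rewrite mulf_eq0 => /orP[/eqP//|/eqP y0].
have := sqr_ge0 x; rewrite expr2; move: e1; rewrite y0 mulr0 subr0 => ->; lra.
Qed.

(** Each factor [d *: 'X^2 - u i] has two opposite, nonzero imaginary roots, and distinct [u i] give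
    disjoint pairs. The scaling [d] makes room for the powers of 2 in the Weyl polynomials. *)
Lemma conservative_comp_sqr c d m (u : nat -> R) : c != 0 -> 0 < d ->
  (forall i, (i < m)%N -> u i < 0) ->
  (forall i j, (i < j < m)%N -> u j < u i) ->
  conservative ((c *: \prod_(i < m) ('X - (u i)%:P)) \Po (d *: 'X^2)).
Proof.
rewrite /conservative => c0 d0 u0 udec /= z.
have dC0 : toC d != 0 by rewrite fmorph_eq0 gt_eqF.
pose f (j : 'I_m) := toC d *: 'X^2 - (toC (u j))%:P.
have -> : map_poly toC ((c *: \prod_(j < m) ('X - (u j)%:P)) \Po (d *: 'X^2)) =
    toC c *: \prod_(j < m) f j.
  rewrite comp_polyZ rmorph_prod/= map_polyZ rmorph_prod/=; congr (_ *: _).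
  apply: eq_bigr => j _.
  by rewrite comp_polyB comp_polyX comp_polyC rmorphB/= map_polyZ map_polyXn map_polyC.
have fE j x : (f j).[x] = toC d * x ^+ 2 - toC (u j).
  by rewrite /f hornerD hornerN hornerC hornerZ hornerXn.
rewrite rootZ ?fmorph_eq0// rootE horner_prod => /prodf_eq0[i _].
rewrite fE subr_eq0 => /eqP zi.
have z2 : z ^+ 2 = toC (u i / d).
  apply: (mulfI dC0). by rewrite zi -rmorphM mulrC divfK// gt_eqF.
have uid : u i / d < 0 by rewrite pmulr_llt0 ?invr_gt0// u0.
split; first exact: sqr_complex_real_lt0 z2.
have z0 : z != 0.
  by apply: contraTneq uid => z0; move: z2; rewrite z0 expr0n/= => -[<-]; rewrite ltxx.
have fi : f i = (toC d *: ('X + z%:P)) * ('X - z%:P).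
  have -> : f i = toC d *: ('X^2 - (z ^+ 2)%:P).
    by rewrite scalerBr -[_ *: _%:P]mul_polyC -polyCM zi.
  by rewrite -scalerAl rmorphXn subr_sqr mulrC.
(* It remains to see that the cofactor of ['X - z%:P] does not vanish at [z]: ['X + z%:P] takes the
   value [2 z], and [f j] the value [u i - u j]. *)
rewrite (bigD1 i)//= fi mulrAC scalerAl mupMr.
  by rewrite -['X - _]expr1 mup_XsubCX eqxx.
rewrite -!scalerAl rootE !hornerZ hornerM hornerD hornerX hornerC.
rewrite !mulf_neq0 ?fmorph_eq0 ?(gt_eqF d0)//.
  by rewrite -mulr2n mulrn_eq0.
rewrite horner_prod; apply/prodf_neq0 => j ji.
rewrite fE zi subr_eq0; apply: contraNneq ji.
move=> /complexI uij; apply/eqP/val_inj.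
case: (ltngtP i j) => // ij.
  by have := udec i j; rewrite ij ltn_ord uij ltxx => /(_ isT).
by have := udec j i; rewrite ij ltn_ord uij ltxx => /(_ isT).
Qed.

(** A complex square root of a root of [p] is a root of [p \Po 'X^2], hence of the form [i t] with
    [t] real, so the root of [p] is [- t ^+ 2]. *)
Lemma conservative_comp_sqr_roots p : conservative (p \Po 'X^2) ->
  p != 0 /\ exists vs : seq R, {in vs, forall v, v < 0} /\
    p = lead_coef p *: \prod_(v <- vs) ('X - v%:P).
Proof.
rewrite /conservative map_comp_poly map_polyXn; set P := map_poly _ p => cons.
have p0 : p != 0.
  (* The zero polynomial would have the root 1, whose real part is not 0. *)
  apply/eqP => p0; have [] := cons 1; last first.
    by move/eqP; rewrite oner_eq0.
  by rewrite /P p0 map_poly0 comp_poly0 root0.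
have P0 : P != 0 by rewrite map_poly_eq0.
have [xs PE] := closed_field_poly_normal P.
have xsE x : x \in xs -> exists2 v : R, v < 0 & x = toC v.
  move=> xxs; have Px : root P x.
    by rewrite PE rootZ ?lead_coef_eq0// root_prod_XsubC.
  have rz z : z ^+ 2 = x -> root (P \Po 'X^2) z.
    by move=> zx; rewrite root_comp hornerXn zx.
  have [z1 z2] := cons _ (rz _ (sqr_sqrtc x)).
  (* If 0 were a root of [p], then ['X^2] would divide [p \Po 'X^2], against the simplicity of its
     root 0. *)
  have x0 : x != 0.
    apply/eqP => x0; move: z2; rewrite x0 sqrtc0 => z2.
    have : (2 <= mup 0 (P \Po 'X^2))%N.
      rewrite mup_geq; last first.
        by rewrite comp_poly_eq0// size_polyXn.
      have /factor_theorem[Q ->] := Px.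
      by rewrite x0 subr0 comp_polyM comp_polyX dvdp_mull.
    by rewrite z2.
  have := sqr_sqrtc x; case: (sqrtc x) z1 => /= y t -> xE.
  exists (- t ^+ 2); last first.
    by rewrite -xE expr2; simpc; rewrite expr2.
  rewrite oppr_lt0 exprn_even_gt0//=; apply: contraNneq x0 => t0.
  by rewrite -xE t0 expr0n.
split=> //; exists (map (@complex.Re R) xs); split.
  by move=> _ /mapP[x /xsE[v v0 ->] ->].
(* The factorization over [R[i]] descends to [R], all its roots being real. *)
apply: (map_poly_inj (toC : {rmorphism R -> R[i]})).
rewrite map_polyZ -lead_coef_map -/P [LHS]PE; congr (_ *: _).
rewrite rmorph_prod big_map !big_seq; apply: eq_bigr => x /xsE[v _ ->].
by rewrite rmorphB/= map_polyX map_polyC.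
Qed.
End Conservative.

(** * Weyl polynomials as images of one polynomial in the squared variable *)

Section Weyl.
Variable R : realType.

Lemma weyl_poly_ooE n (w : nat -> R) :
  weyl_poly_oo n w = (\sum_(l < n./2.+1) w (2 * l)%N *: 'X^l) \Po 'X^2.
Proof.
rewrite /weyl_poly_oo linear_sum/=; apply: eq_bigr => l _.
by rewrite comp_polyZ comp_Xn_poly exprM.
Qed.

Lemma Gamma_rising (a : R) l : 0 < a ->
  Gamma (a + l%:R + 1) = Gamma (a + 1) * rising a l.
Proof.
move=> a0; elim: l => [|l IH]; first by rewrite /rising big_ord0 addr0 mulr1.
have l0 : 0 <= l%:R :> R by [].
rewrite risingS mulrA -IH -[l.+1%:R]natr1 [in LHS]addrA GammaS; last lra.
by rewrite -[in RHS]addrA mulrC addrA.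
Qed.

(** The Gamma quotient is the inverse of [rising (p / 2) l], and the factor [2 ^- l] is absorbed by
    substituting ['X^2 / 2]. *)
Lemma weyl_polyE n (w : nat -> R) p : (0 < p)%N ->
  weyl_poly n w p = laguerre (p%:R / 2)
     (\sum_(l < n./2.+1) w (2 * l)%N *: 'X^l) \Po (2^-1 *: 'X^2).
Proof.
move=> p0; set a := p%:R / 2.
have a0 : 0 < a by rewrite divr_gt0// ltr0n.
have -> : laguerre a (\sum_(l < n./2.+1) w (2 * l)%N *: 'X^l) =
   \sum_(l < n./2.+1) (w (2 * l)%N / rising a l) *: 'X^l.
  apply/polyP => k; rewrite coef_laguerre !coef_sum mulr_suml.
  apply: eq_bigr => l _; rewrite !coefZ coefXn.
  by case: eqP => [->|_]; rewrite ?mulr1// !mulr0 mul0r.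
rewrite /weyl_poly linear_sum/=; apply: eq_bigr => l _.
rewrite comp_polyZ comp_Xn_poly exprZn scalerA -exprM; congr (_ *: _).
rewrite -/a Gamma_rising// exprVn.
have G0 : Gamma (a + 1) != 0 by rewrite gt_eqF// Gamma_gt0//; lra.
have r0 : rising a l != 0 by rewrite gt_eqF// rising_gt0//; lra.
field.
by rewrite G0 r0 expf_neq0//.
Qed.

End Weyl.

Theorem lemma2p4 (R : realType) (n N : nat) (M : set 'rV[R]_N) (w : nat -> R)
    (hM : weyl_coefficients n M w) (hoo : conservative (weyl_poly_oo n w)) :
  forall p : nat, (0 < p)%N -> conservative (weyl_poly n w p).
Proof.
move=> p p0; move: hoo; rewrite weyl_poly_ooE weyl_polyE//.
set h := \sum_(l < _) _ => /conservative_comp_sqr_roots[h0 [vs [vs0 hE]]].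
have a1 : -1 < p%:R / 2 :> R by apply: (@lt_le_trans _ _ 0); rewrite ?ltrN10// divr_ge0.
have [u [u0 udec qE]] := laguerre_prod_XsubC a1 vs0.
(* The leading coefficient of [h] passes through [T_a], leaving a scalar multiple of a product with
   simple negative roots. *)
rewrite hE laguerreZ qE scalerA.
apply: conservative_comp_sqr => //.
rewrite mulf_neq0 ?lead_coef_eq0// -size_poly_eq0 size_laguerre//.
by rewrite size_prod_XsubC.
Qed.
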